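(* Let $F_2=F(a,b)$ be the free group over $\{a,b\}$, let $\Psi(F_2)$ be the set of all purely hyperbolic pseudo-lengths $F_2\to\mathbb{R}_{+}$, and let $Y':=Y_1\cup Y_2$, where $$Y_1:=\{\lVert\cdot\rVert_{\alpha,\beta,\alpha+\beta,\delta}:\ \alpha,\beta,\delta\in\mathbb{R},\ \alpha+\beta>\delta\ge\alpha\ge\beta>0\},$$ $$Y_2:=\{\lVert\cdot\rVert_{\alpha,\beta,\gamma,\gamma}:\ \alpha,\beta,\gamma\in\mathbb{R},\ \alpha\ge\beta>0,\ \gamma\ge\alpha+\beta\}.$$ Then every $\mathrm{Aut}(F_2)$-orbit in $\Psi(F_2)$ contains an element of $Y'$.
   Context: Here $\Lambda=\mathbb{R}$ and $\mathbb{R}_{+}:=\{\lambda\in\mathbb{R}:\lambda\ge0\}$. A function $\lVert\cdot\rVert\colon G\to\mathbb{R}_{+}$ on a group $G$ is a (real-valued) pseudo-length if: (A1) $\lVert ghg^{-1}\rVert=\lVert h\rVert$ for any $g,h\in G$; (A2) $\lVert gh\rVert=\lVert gh^{-1}\rVert$ or $\max\{\lVert gh\rVert,\lVert gh^{-1}\rVert\}\le\lVert g\rVert+\lVert h\rVert$, for any $g,h\in G$; (A3) $\lVert gh\rVert=\lVert gh^{-1}\rVert>\lVert g\rVert+\lVert h\rVert$ or $\max\{\lVert gh\rVert,\lVert gh^{-1}\rVert\}=\lVert g\rVert+\lVert h\rVert$, for any $g,h\in G$ with $\lVert g\rVert>0$, $\lVert h\rVert>0$. (For general ordered abelian groups $\Lambda$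 there is an additional axiom (A0), $\max\{0,\lVert gh\rVert-\lVert g\rVert-\lVert h\rVert\}\in2\Lambda$ whenever $\lVert g\rVert,\lVert h\rVert>0$, which is vacuous for $\Lambda=\mathbb{R}$.) A pseudo-length is purely hyperbolic if $\lVert g\rVert>0$ for all $g\ne1$. The group $\mathrm{Aut}(F_2)$ acts on $\Psi(F_2)$ on the right: $\sigma\in\mathrm{Aut}(F_2)$ sends $\lVert\cdot\rVert$ to the pseudo-length $g\mapsto\lVert\sigma(g)\rVert$. For $\alpha,\beta,\gamma,\delta\in\mathbb{R}$ such that either $\gamma=\delta>\alpha+\beta$ or $\max\{\gamma,\delta\}=\alpha+\beta$, and such that $\alpha>0$, $\beta>0$, $|\alpha-\beta|<\min\{\gamma,\delta\}$, the symbol $\lVert\cdot\rVert_{\alpha,\beta,\gamma,\delta}$ denotes the unique pseudo-length $F_2\to\mathbb{R}_{+}$ taking the values $\alpha,\beta,\gamma,\delta$ at $a$, $b$, $ab$, $ab^{-1}$, respectively (it exists, is unique, and is purely hyperbolic). *)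

(* Defs.v *)
From HB Require Import structures.
From mathcomp Require Import all_boot all_order all_algebra.
From mathcomp Require Import boolp classical_sets reals.

Set Implicit Arguments.
Unset Strict Implicit.
Unset Printing Implicit Defensive.

Import Order.TTheory GRing.Theory Num.Theory.
Local Open Scope classical_set_scope.
Local Open Scope ring_scope.

(** The free group over [T], as the group of reduced words. The letter
    [(x, false)] stands for the generator [x], and [(x, true)] for its
    inverse. The product reduces the concatenation. *)
Section FreeGroup.
Variable T : choiceType.

Definition letter : Type := (T * bool)%type.

Definition linv (x : letter) : letter := (x.1, ~~ x.2).

Definition reduced (w : seq letter) : bool :=
  sorted (fun x y => y != linv x) w.

Definition lcons (x : letter) (w : seq letter) : seq letter :=
  if w is y :: w' then if y == linv x then w' else x :: w else [:: x].

Definition wmul (u v : seq letter) : seq letter := foldr lcons v u.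

Definition winv (u : seq letter) : seq letter := rev (map linv u).

Record free_group : Type :=
  FreeWord { word :> seq letter; word_reduced : reduced word }.

HB.instance Definition _ := [isSub for word].
HB.instance Definition _ := [Choice of free_group by <:].

Lemma linvK : involutive linv.
Proof. by case=> x b; rewrite /linv /= negbK. Qed.

Lemma lcons_reduced x w : reduced w -> reduced (lcons x w).
Proof.
case: w => [//|y w] /= rw; case: eqP => [_|/eqP nyx].
  exact: path_sorted rw.
by rewrite /= nyx.
Qed.

Lemma wmul_reduced u v : reduced v -> reduced (wmul u v).
Proof. by move=> rv; elim: u => //= x u IHu; apply: lcons_reduced. Qed.

Lemma lconsK x w : reduced w -> lcons (linv x) (lcons x w) = w.
Proof.
case: w => [|y w] rw /=; first by rewrite linvK eqxx.
case: eqP => [Ey|_] /=; last by rewrite linvK eqxx.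
by subst y; case: w rw => [//|z w] /= /andP[/negPf-> _].
Qed.

Lemma wmul_lcons x u v :
  reduced v -> wmul (lcons x u) v = lcons x (wmul u v).
Proof.
move=> rv; case: u => [//|y u] /=; case: eqP => [->|_] //=.
by rewrite -{1}(linvK x) lconsK //; apply: wmul_reduced.
Qed.

Lemma wmulA u v w : reduced w -> wmul u (wmul v w) = wmul (wmul u v) w.
Proof. by move=> rw; elim: u => //= x u ->; rewrite wmul_lcons. Qed.

Lemma wmulw1 u : reduced u -> wmul u [::] = u.
Proof.
elim: u => [//|x u IHu] ru /=; rewrite IHu; last exact: path_sorted ru.
by case: u ru {IHu} => //= y u /andP[/negPf-> _].
Qed.

Lemma winv_reduced u : reduced u -> reduced (winv u).
Proof.
move=> ru; rewrite /winv /reduced rev_sorted sorted_map.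
apply: sub_sorted ru => x y /=.
by rewrite linvK eq_sym.
Qed.

Lemma wmul_cat u v w : wmul (u ++ v) w = wmul u (wmul v w).
Proof. exact: foldr_cat. Qed.

Lemma wmulKw u v : reduced v -> wmul (winv u) (wmul u v) = v.
Proof.
move=> rv; elim: u => //= x u IHu.
rewrite /winv /= rev_cons -cats1 wmul_cat /= lconsK ?IHu //.
exact: wmul_reduced.
Qed.

Lemma winvK u : winv (winv u) = u.
Proof.
rewrite /winv map_rev revK -map_comp -[RHS]map_id.
by apply: eq_map => x /=; rewrite linvK.
Qed.

Definition fg_one : free_group := @FreeWord [::] isT.
Definition fg_mul (g h : free_group) : free_group :=
  FreeWord (wmul_reduced g (word_reduced h)).
Definition fg_inv (g : free_group) : free_group :=
  FreeWord (winv_reduced (word_reduced g)).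

Lemma fg_mulA : associative fg_mul.
Proof. by move=> g h k; apply: val_inj; apply/wmulA/word_reduced. Qed.
Lemma fg_mul1g : left_id fg_one fg_mul.
Proof. by move=> g; apply: val_inj. Qed.
Lemma fg_mulg1 : right_id fg_one fg_mul.
Proof. by move=> g; apply: val_inj; apply/wmulw1/word_reduced. Qed.
Lemma fg_mulVg : left_inverse fg_one fg_inv fg_mul.
Proof.
move=> g; apply: val_inj => /=.
by rewrite -{2}(wmulw1 (word_reduced g)) wmulKw.
Qed.
Lemma fg_mulgV : right_inverse fg_one fg_inv fg_mul.
Proof.
move=> g; apply: val_inj => /=.
rewrite -{1}(winvK g) -{2}(wmulw1 (winv_reduced (word_reduced g))).
by rewrite wmulKw.
Qed.

HB.instance Definition _ := isGroup.Build free_group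
  fg_mulA fg_mul1g fg_mulg1 fg_mulVg fg_mulgV.

Definition gen (x : T) : free_group := @FreeWord [:: (x, false)] isT.

(** The universal property of the free group. *)
Section Lift.
Variables (G : groupType) (f : T -> G).

Definition lletter (x : letter) : G := if x.2 then (f x.1)^-1%g else f x.1.

Definition wlift (w : seq letter) : G :=
  foldr (fun x g => lletter x * g)%g 1%g w.

Definition free_lift (g : free_group) : G := wlift g.

Lemma lletterV x : lletter (linv x) = (lletter x)^-1%g.
Proof. by case: x => x [] //=; rewrite /lletter /= invgK. Qed.

Lemma wlift_mul u v : wlift (wmul u v) = (wlift u * wlift v)%g.
Proof.
elim: u => [|x u IHu] /=; first by rewrite mul1g.
rewrite -mulgA -IHu; case: (wmul u v) => [//|y w] /=.
by case: eqP => [->|//]; rewrite lletterV mulVKg.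
Qed.

Lemma free_liftM : {morph free_lift : g h / (g * h)%g}.
Proof. by move=> g h; apply: wlift_mul. Qed.

HB.instance Definition _ := isMultiplicative.Build _ _ free_lift free_liftM.
HB.instance Definition _ :=
  Multiplicative_isUMagmaMorphism.Build free_group G free_lift erefl.

Lemma free_lift_gen x : free_lift (gen x) = f x.
Proof. exact: mulg1. Qed.

Lemma free_lift_unique (h : {multiplicative free_group -> G}) :
  (forall x, h (gen x) = f x) -> h =1 free_lift.
Proof.
move=> hf.
have h1 : h 1%g = 1%g.
  by apply: (@mulgI _ (h 1%g)); rewrite -gmulfM !mulg1.
have hV g : h (g^-1)%g = (h g)^-1%g.
  by apply: (@mulgI _ (h g)); rewrite -gmulfM !mulgV h1.
case=> w; rewrite /free_lift /=; elim: w => [|x w IHw] rw.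
  by rewrite -[RHS]h1; congr (h _); apply: val_inj.
have rw' : reduced w by apply: path_sorted rw.
rewrite /= -(IHw rw').
have -> : FreeWord rw = (@FreeWord [:: x] isT * FreeWord rw')%g.
  apply: val_inj => /=; case: (w) rw {rw' IHw} => //= y w' /andP[/negPf-> _] //.
rewrite gmulfM; congr (_ * _)%g.
case: x {rw} => x []; rewrite /lletter /= -hf -?hV.
  by congr (h _); apply: val_inj.
by congr (h _); apply: val_inj.
Qed.

End Lift.
End FreeGroup.

Definition F2 : groupType := free_group bool.
Definition a : F2 := gen true.
Definition b : F2 := gen false.

Section PseudoLength.
Variables (R : realType) (G : groupType).
Implicit Type l : G -> R.

(** The first field states that [l] takes its values in R_+. *)
Record pseudo_length l : Prop := PseudoLength {
  pl_ge0 : forall g, 0 <= l g;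
  pl_A1 : forall g h, l (g * h * g^-1)%g = l h;
  pl_A2 : forall g h, l (g * h)%g = l (g * h^-1)%g \/
    Num.max (l (g * h)%g) (l (g * h^-1)%g) <= l g + l h;
  pl_A3 : forall g h, 0 < l g -> 0 < l h ->
    (l (g * h)%g = l (g * h^-1)%g /\ l (g * h^-1)%g > l g + l h) \/
    Num.max (l (g * h)%g) (l (g * h^-1)%g) = l g + l h }.

Definition purely_hyperbolic l : Prop := forall g, g <> 1%g -> 0 < l g.

Definition Psi : set (G -> R) :=
  [set l | pseudo_length l /\ purely_hyperbolic l].

(** The orbit of [l] under the right action of Aut(G) by precomposition. *)
Definition Aut_orbit l : set (G -> R) :=
  [set l \o s | s in [set s : {multiplicative G -> G} | bijective s]].

End PseudoLength.

Section F2Lengths.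
Variable R : realType.

(** The pseudo-length on [F2] taking the given values at a, b, ab, ab^-1.
    It exists and is unique if [al, be > 0], [`|al - be| < min ga de], and
    either [ga = de > al + be] or [max ga de = al + be]; the junk value 0 of
    [xget] is only reached outside this range. The parameters in [Y1] and [Y2]
    all lie in this range. *)
Definition norm4 (al be ga de : R) : F2 -> R :=
  xget (fun=> 0) [set l : F2 -> R | pseudo_length l /\
    [/\ l a = al, l b = be, l (a * b)%g = ga & l (a * b^-1)%g = de]].

Definition Y1 : set (F2 -> R) :=
  [set l | exists al be de : R,
    [/\ al + be > de, de >= al, al >= be & be > 0] /\
    l = norm4 al be (al + be) de].

Definition Y2 : set (F2 -> R) :=
  [set l | exists al be ga : R,
    [/\ al >= be, be > 0 & ga >= al + be] /\
    l = norm4 al be ga ga].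

Definition Y' : set (F2 -> R) := Y1 `|` Y2.

End F2Lengths.

(* Main.v *)
Require Import Defs.
From mathcomp Require Import all_boot all_order all_algebra.
From mathcomp Require Import boolp classical_sets reals.
From mathcomp Require Import lra.

Set Implicit Arguments.
Unset Strict Implicit.
Unset Printing Implicit Defensive.

Import Order.TTheory GRing.Theory Num.Theory.
Local Open Scope classical_set_scope.
Local Open Scope ring_scope.

(** Start from the basis (a, b). If |ab| = |ab^-1| >= |a| + |b| we are in [Y2];
    otherwise, up to inverting b, |ab| = |a| + |b| > |ab^-1|, and if |ab^-1| is at
    least |a| and |b| we are in [Y1]. In the remaining case, with |a| >= |b|,
    replacing a by ab^-1 either lands in [Y1] or [Y2] or is a step of the
    subtractive Euclidean algorithm on (|a|, |b|). An infinite run would make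
    |a| + |b| arbitrarily small, whereas the commutator keeps its positive length
    and that length is at most 2 (|a| + |b|).

    Since [norm4] is defined by choice, uniqueness of a pseudo-length with the
    given four values is needed as well. It follows from an explicit formula for
    the length of a cyclically reduced word as a sum over its turns, proved by
    induction: a word in which a letter repeats is conjugate to xu.xv, and (A3)
    for this product is decided by the shorter word uv^-1; the only long words
    without a repeated letter are commutators of two generators. *)

(** * Elementary consequences of the axioms *)

Section PseudoLengthTheory.
Variables (R : realType) (G : groupType) (l : G -> R).
Hypothesis pl : pseudo_length l.

Lemma pl_mulC g h : l (g * h)%g = l (h * g)%g.
Proof. by rewrite -(pl_A1 pl h (g * h)%g) mulgA mulgK. Qed.

Lemma pl_one : l 1%g = 0.
Proof.
apply/eqP; rewrite eq_le (pl_ge0 pl) andbT leNgt; apply/negP => l1.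
case: (pl_A3 pl l1 l1); rewrite invg1 mulg1 ?maxxx; lra.
Qed.

Lemma pl_inv g : l g^-1%g = l g.
Proof.
have le h : l h^-1%g <= l 1%g + l h.
  case: (pl_A2 pl 1%g h); rewrite !mul1g; first by have := pl_ge0 pl 1%g; lra.
  by rewrite ge_max => /andP[].
by have := le g; have := le g^-1%g; rewrite invgK pl_one; lra.
Qed.

(** (A2) for [g] and [h g^-1 h^-1] leaves only the case of equality with the length of
    [(g h) (g h^-1)]; (A2) for these two factors leaves only equality with that of [g h h g^-1], a
    conjugate of [h h]. *)
Lemma pl_comm_le g h :
  l (g * h)%g <= l g + l h -> l (g * h^-1)%g <= l g + l h ->
  l (g * h * g^-1 * h^-1)%g <= 2 * (l g + l h).
Proof.
move=> le1 le2; have g0 := pl_ge0 pl g; have h0 := pl_ge0 pl h.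
have hh : l (h * h)%g <= 2 * l h.
  case: (pl_A2 pl h h); rewrite mulgV ?pl_one ?ge_max; first by move=> ->; lra.
  by case/andP => ? _; lra.
have e1 : l (h * g^-1 * h^-1)%g = l g by rewrite (pl_A1 pl) pl_inv.
case: (pl_A2 pl g (h * g^-1 * h^-1)%g); last first.
  by rewrite ge_max e1 !mulgA => /andP[? _]; lra.
rewrite !invgM !invgK !mulgA => ->.
case: (pl_A2 pl (g * h)%g (g * h^-1)%g); last first.
  by rewrite ge_max !mulgA => /andP[? _]; lra.
rewrite invgM invgK !mulgA => ->.
by rewrite -(mulgA g h h) (pl_A1 pl); lra.
Qed.

End PseudoLengthTheory.

(** * Cyclically reduced words *)

Section CyclicWords.
Variable T : choiceType.
Implicit Types (x y : letter T) (s w u v : seq (letter T)).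

Definition cyc_reduced w := cycle (fun x y => y != linv x) w.

Lemma winv_cons x s :
  winv (x :: s) = linv (last x s) :: rev (map (@linv T) (belast x s)).
Proof. by rewrite /winv lastI map_rcons rev_rcons. Qed.

Lemma size_winv w : size (winv w) = size w.
Proof. by rewrite /winv size_rev size_map. Qed.

Lemma winv_cat u v : winv (u ++ v) = winv v ++ winv u.
Proof. by rewrite /winv map_cat rev_cat. Qed.

Lemma cyc_reduced_catC u v : cyc_reduced (u ++ v) = cyc_reduced (v ++ u).
Proof. by rewrite /cyc_reduced -rot_size_cat rot_cycle. Qed.

Lemma cyc_reduced_winv w : cyc_reduced (winv w) = cyc_reduced w.
Proof.
rewrite /cyc_reduced /winv rev_cycle; apply: mono_cycle => x y /=.
by rewrite linvK eq_sym.
Qed.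

Lemma cyc_reduced_split x u v :
  cyc_reduced (x :: u ++ x :: v) -> cyc_reduced (x :: u) /\ cyc_reduced (x :: v).
Proof.
by rewrite /cyc_reduced /= rcons_cat cat_path /= !rcons_path => /and4P[-> -> -> ->].
Qed.

Lemma last_cyc_reduced x s : cyc_reduced (x :: s) -> linv (last x s) != x.
Proof. by rewrite /cyc_reduced /= rcons_path eq_sym => /andP[]. Qed.

Lemma not_uniq_split w : ~~ uniq w -> exists p x u v, w = p ++ x :: u ++ x :: v.
Proof.
elim: w => //= y s IHs; rewrite negb_and negbK; case/orP.
  by case/splitPr=> u v; exists [::], y, u, v.
by case/IHs=> p [x [u [v ->]]]; exists (y :: p), x, u, v.
Qed.

Lemma not_reduced_split w :
  ~~ reduced w -> exists p x q, w = p ++ x :: linv x :: q.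
Proof.
rewrite /reduced; case: w => //= x s.
elim: s x => //= y s IHs x; rewrite negb_and negbK => /orP[/eqP->|].
  by exists [::], x, s.
by case/IHs=> p [z [q ->]]; exists (x :: p), z, q.
Qed.

(** The cancelling pair may join the last letter to the first, hence the rotation [q ++ p]. *)
Lemma not_cyc_reduced_split w : ~~ cyc_reduced w ->
  exists p q x s, w = p ++ q /\ q ++ p = x :: linv x :: s.
Proof.
case: w => // x s; rewrite /cyc_reduced /= rcons_path negb_and negbK => /orP[].
  case/(@not_reduced_split (x :: s))=> p [z [q ->]].
  by exists p, (z :: linv z :: q), z, (q ++ p).
case/lastP: s => [|s z]; first by case: x => x [] /= /eqP[].
rewrite last_rcons => /eqP->; exists (linv z :: s), [:: z], z, s.
by rewrite cats1.
Qed.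

Variables (G : groupType) (f : T -> G).

Lemma wlift_cat u v : wlift f (u ++ v) = (wlift f u * wlift f v)%g.
Proof. by elim: u => [|x u IHu] /=; rewrite ?mul1g // IHu mulgA. Qed.

Lemma wlift_winv w : wlift f (winv w) = (wlift f w)^-1%g.
Proof.
elim: w => [|x w IHw]; first by rewrite invg1.
by rewrite -cat1s winv_cat !wlift_cat IHw invgM /= lletterV !mulg1.
Qed.

End CyclicWords.

(** * Length of a cyclic word as a sum over turns *)

(** [d x y] stands for the distance, in a tree on which the group acts, between
    the midpoints of the edges leaving the base vertex in directions [x] and [y]. *)
Section CyclicLength.
Variables (R : realType) (T : choiceType) (d : letter T -> letter T -> R).
Implicit Types (x y z : letter T) (s w u v : seq (letter T)).

(** After [x] the path looks back along [linv x] and forward along [y]; this pair is the turn. *)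
Fixpoint path_len x s : R :=
  if s is y :: s' then d (linv x) y + path_len y s' else 0.

Definition cyc_len w : R := if w is x :: s then path_len x (rcons s x) else 0.

Lemma path_len_cat x u v :
  path_len x (u ++ v) = path_len x u + path_len (last x u) v.
Proof. by elim: u x => [|y u IHu] x /=; rewrite ?add0r // IHu addrA. Qed.

Lemma path_len_rcons x s y :
  path_len x (rcons s y) = path_len x s + d (linv (last x s)) y.
Proof. by rewrite -cats1 path_len_cat /= addr0. Qed.

Lemma cyc_len_catC u v : cyc_len (u ++ v) = cyc_len (v ++ u).
Proof.
case: u v => [|x u] [|y v]; rewrite ?cats0 //= !path_len_rcons !path_len_cat.
by rewrite !last_cat /=; lra.
Qed.

Lemma cyc_len_split x u v :
  cyc_len (x :: u ++ x :: v) = cyc_len (x :: u) + cyc_len (x :: v).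
Proof. by rewrite /= rcons_cat path_len_cat /= !path_len_rcons; lra. Qed.

Hypothesis d_sym : forall x y, d x y = d y x.

Lemma path_len_rev x s :
  path_len (linv (last x s)) (rev (map (@linv T) (belast x s))) = path_len x s.
Proof.
elim: s x => //= y s IHs x; rewrite rev_cons path_len_rcons IHs addrC.
congr (_ + _); case: s {IHs} => [|z s] /=; first by rewrite linvK d_sym.
by rewrite rev_cons last_rcons linvK d_sym.
Qed.

Lemma last_winv x s : last (linv (last x s)) (rev (map (@linv T) (belast x s))) = linv x.
Proof. by case: s => //= y s; rewrite rev_cons last_rcons. Qed.

Lemma cyc_len_winv w : cyc_len (winv w) = cyc_len w.
Proof.
case: w => // x s; rewrite winv_cons /= !path_len_rcons path_len_rev last_winv.
by rewrite linvK d_sym.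
Qed.

Hypothesis d_refl : forall x, d x x = 0.
Hypothesis d_tri : forall x y z, d x z <= d x y + d y z.

Lemma d_ge0 x y : 0 <= d x y.
Proof. by have := d_tri x y x; rewrite d_refl (d_sym y); lra. Qed.

Lemma path_len_ge0 x s : 0 <= path_len x s.
Proof. by elim: s x => //= y s IHs x; rewrite addr_ge0 ?d_ge0. Qed.

Lemma cyc_len_ge0 w : 0 <= cyc_len w.
Proof. by case: w => // x s; apply: path_len_ge0. Qed.

Lemma cyc_len_cancel x s : cyc_len s <= cyc_len (x :: linv x :: s).
Proof.
case: s => [|y s]; first exact: cyc_len_ge0.
rewrite /= !path_len_rcons !linvK d_refl.
by have := d_tri (linv (last y s)) x y; lra.
Qed.

Lemma cyc_len_mulV x u v :
  cyc_len ((x :: u) ++ winv (x :: v)) =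
  path_len x u + path_len x v + d (linv (last x u)) (linv (last x v)).
Proof.
rewrite winv_cons /= path_len_rcons path_len_cat last_cat /= path_len_rev.
by rewrite last_winv linvK d_refl; lra.
Qed.

Lemma cyc_reduce (G : groupType) (f : T -> G) w : ~~ cyc_reduced w ->
  exists w' c, [/\ (size w' < size w)%N, cyc_len w' <= cyc_len w &
    wlift f w = (c * wlift f w' * c^-1)%g].
Proof.
case/not_cyc_reduced_split=> p [q [x [s [-> e]]]].
exists s, (wlift f p); split.
- by rewrite size_cat addnC -size_cat e.
- by rewrite cyc_len_catC e; apply: cyc_len_cancel.
have : wlift f (q ++ p) = wlift f s by rewrite e /= lletterV mulVKg.
by rewrite !wlift_cat => <-; rewrite !mulgA mulgK.
Qed.

End CyclicLength.

(** * The turn formula for cyclically reduced words *)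

Section LengthOfWords.
Implicit Types (x y z : letter bool) (u v w p : seq (letter bool)).
Variables (R : realType) (d : letter bool -> letter bool -> R).
Hypothesis d_sym : forall x y, d x y = d y x.
Hypothesis d_refl : forall x, d x x = 0.
Hypothesis d_tri : forall x y z, d x z <= d x y + d y z.
(* Negative letters lie on no geodesic between two other letters; it is enough to
   know this for one letter of each pair [x], [linv x], since [l] is invariant
   under inversion. *)
Hypothesis d_leaf : forall x y z : letter bool, x.2 -> y != x -> z != x ->
  d y z < d y x + d x z.

Variables (G : groupType) (f : bool -> G) (l : G -> R).
Hypothesis pl : pseudo_length l.
Hypothesis l1 : forall x, l (wlift f [:: x]) = cyc_len d [:: x].
Hypothesis l2 : forall x y : letter bool, y != x -> y != linv x ->
  l (wlift f [:: x; y]) = cyc_len d [:: x; y].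

Let ev := wlift f.

(** Strictness at the leaf [x] makes the closing turn positive; (A3) needs this. *)
Lemma cyc_len_leaf_gt0 x u : x.2 -> cyc_reduced (x :: u) -> 0 < cyc_len d (x :: u).
Proof.
move=> x2 /last_cyc_reduced nx; rewrite /= path_len_rcons.
have := d_leaf x2 nx nx; rewrite d_refl (d_sym x).
by have := path_len_ge0 d_sym d_refl d_tri x u; lra.
Qed.

Lemma l_catC u v : l (ev (u ++ v)) = l (ev (v ++ u)).
Proof. by rewrite /ev !wlift_cat (pl_mulC pl). Qed.

Lemma l_winv w : l (ev (winv w)) = l (ev w).
Proof. by rewrite /ev wlift_winv (pl_inv pl). Qed.

Definition len_agree n := forall w, (size w <= n)%N -> cyc_reduced w ->
  l (ev w) = cyc_len d w.

Lemma len_agree_le n w : len_agree n -> (size w <= n)%N ->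
  l (ev w) <= cyc_len d w.
Proof.
move=> IH; elim: {w}(size w) {-2}w (leqnn (size w)) => [|m IHm] w.
  by rewrite leqn0 => /nilP-> _; rewrite /ev (pl_one pl).
move=> wm wn; have [/(IH w wn)->//|] := boolP (cyc_reduced w).
case/(cyc_reduce d_sym d_refl d_tri f) => w' [c [sw' le e]].
rewrite /ev e (pl_A1 pl) (le_trans _ le) // IHm //.
  by rewrite -ltnS (leq_trans sw').
exact: leq_trans (ltnW sw') wn.
Qed.

(* The axes of [xu] and [xv] share more than a point because both words start
   with the leaf [x]; so [l] of the quotient is strictly below the sum, which
   decides the alternative of (A3). *)
Lemma len_agree_leaf n p x u v : len_agree n -> x.2 ->
  (size (p ++ x :: u ++ x :: v) <= n.+1)%N ->
  cyc_reduced (p ++ x :: u ++ x :: v) ->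
  l (ev (p ++ x :: u ++ x :: v)) = cyc_len d (p ++ x :: u ++ x :: v).
Proof.
move=> IH x2; rewrite l_catC cyc_len_catC cyc_reduced_catC.
rewrite size_cat addnC -size_cat.
have -> : (x :: u ++ x :: v) ++ p = x :: u ++ x :: v ++ p by rewrite /= -catA.
move: {v p}(v ++ p) => v sw cw.
have [cu cv] := cyc_reduced_split cw.
have sn : (size u + size v < n)%N by move: sw; rewrite /= size_cat /= addnS !ltnS.
have lu : l (ev (x :: u)) = cyc_len d (x :: u).
  by apply: IH => //=; apply: leq_trans sn; rewrite ltnS leq_addr.
have lv : l (ev (x :: v)) = cyc_len d (x :: v).
  by apply: IH => //=; apply: leq_trans sn; rewrite ltnS leq_addl.
have lt : l (ev (x :: u) * (ev (x :: v))^-1)%g <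
          cyc_len d (x :: u) + cyc_len d (x :: v).
  (* This word may have [n.+1] letters; its last and first letters cancel, so a reduction brings it
     within reach of [IH]. *)
  have ncr : ~~ cyc_reduced ((x :: u) ++ winv (x :: v)).
    apply/negP; rewrite winv_cons => /last_cyc_reduced.
    by rewrite last_cat /= last_winv linvK eqxx.
  have [w' [c [sw' le e]]] := cyc_reduce d_sym d_refl d_tri f ncr.
  have -> : (ev (x :: u) * (ev (x :: v))^-1)%g = (c * ev w' * c^-1)%g.
    by rewrite -e wlift_cat wlift_winv.
  rewrite (pl_A1 pl); apply: (@le_lt_trans _ _ (cyc_len d w')).
    apply: (len_agree_le IH); rewrite -ltnS; apply: leq_trans sw' _.
    by rewrite size_cat size_winv /= addSn addnS ltnS.
  apply: le_lt_trans le _; rewrite cyc_len_mulV //= !path_len_rcons.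
  have := d_leaf x2 (last_cyc_reduced cu) (last_cyc_reduced cv).
  by rewrite (d_sym x); lra.
have -> : ev (x :: u ++ x :: v) = (ev (x :: u) * ev (x :: v))%g.
  by rewrite /ev -wlift_cat.
rewrite cyc_len_split.
have gu := cyc_len_leaf_gt0 x2 cu; have gv := cyc_len_leaf_gt0 x2 cv.
rewrite -lu in gu lt *; rewrite -lv in gv lt *.
case: (pl_A3 pl gu gv) => [[_ ?]|]; first lra.
by case: ltgtP; lra.
Qed.

(** If the repeated letter is positive, inverting the word makes it a leaf. *)
Lemma len_agree_not_uniq n w : len_agree n -> (size w <= n.+1)%N ->
  cyc_reduced w -> ~~ uniq w -> l (ev w) = cyc_len d w.
Proof.
move=> IH sw cw /not_uniq_split[p [x [u [v e]]]].
have [x2|] := boolP x.2; first by rewrite e (len_agree_leaf IH) // -e.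
move=> nx; rewrite -l_winv -(cyc_len_winv d_sym).
rewrite -size_winv in sw; rewrite -cyc_reduced_winv in cw.
have ew : winv w = winv v ++ linv x :: winv u ++ linv x :: winv p.
  rewrite e winv_cat -[x :: u ++ _]cat1s -[x :: v]cat1s !winv_cat.
  by rewrite -!catA.
by rewrite ew (len_agree_leaf IH) -?ew.
Qed.

(** The word [x y x y^-1] has the same turns up to symmetry and repeats [x]. It is the quotient of
    [x] by [y x^-1 y^-1] and longer than their lengths together, so (A2) gives their product the
    same length. *)
Lemma len_agree_comm x y : len_agree 3 -> y != x -> y != linv x ->
  l (ev [:: x; y; linv x; linv y]) = cyc_len d [:: x; y; linv x; linv y].
Proof.
move=> IH yx yx'.
have e : l (ev [:: x; y; x; linv y]) = cyc_len d [:: x; y; x; linv y].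
  apply: (len_agree_not_uniq IH) => //; last by rewrite /= !inE eqxx orbT.
  move: yx yx'; rewrite /cyc_reduced /=.
  by case: x => [[] []]; case: y => [[] []].
have -> : cyc_len d [:: x; y; linv x; linv y] = cyc_len d [:: x; y; x; linv y].
  by rewrite /= !linvK (d_sym (linv y) (linv x)) (d_sym (linv y) x); lra.
rewrite -e.
have lt : l (ev [:: x]) + l (ev [:: y; linv x; linv y]) <
          l (ev [:: x; y; x; linv y]).
  have -> : ev [:: y; linv x; linv y] = (ev [:: y] * ev [:: linv x] * (ev [:: y])^-1)%g.
    by rewrite /ev -wlift_winv -!wlift_cat.
  rewrite (pl_A1 pl) -[l (ev [:: linv x])]/(l (ev (winv [:: x]))) l_winv e /ev l1 /= !linvK.
  (* Two routes from [linv x] to [x], via [y] and via [linv y]; the one via a negative letter is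
     strictly longer. *)
  have t1 := d_tri (linv x) y x; have t2 := d_tri (linv x) (linv y) x.
  case: (boolP y.2) => y2.
    have := @d_leaf y (linv x) x y2; rewrite !(eq_sym _ y) => /(_ yx' yx).
    by lra.
  have := @d_leaf (linv y) (linv x) x y2.
  have -> : linv x != linv y by apply: contraNneq yx => /(can_inj (@linvK _))->.
  have -> : x != linv y by apply: contraNneq yx' => ->; rewrite linvK.
  by move=> /(_ isT isT); lra.
have -> : ev [:: x; y; linv x; linv y] = (ev [:: x] * ev [:: y; linv x; linv y])%g.
  by rewrite /ev -wlift_cat.
have e2 : ev [:: x; y; x; linv y] = (ev [:: x] * (ev [:: y; linv x; linv y])^-1)%g.
  by rewrite /ev -wlift_winv -wlift_cat /winv /= !linvK.
have [->//|le] := pl_A2 pl (ev [:: x]) (ev [:: y; linv x; linv y]).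
  by rewrite e2.
by move: le lt; rewrite -e2 ge_max => /andP[_ ?]; lra.
Qed.

(** There are four letters in all. Three distinct ones contain an inverse pair, adjacent in a
    3-cycle; four must place inverse letters opposite. *)
Lemma cyc_reduced_uniqP w : cyc_reduced w -> uniq w ->
  [\/ w = [::], exists x, w = [:: x],
      exists x y, [/\ w = [:: x; y], y != x & y != linv x] |
      exists x y, [/\ w = [:: x; y; linv x; linv y], y != x & y != linv x]].
Proof.
move=> cw uw; have : (size w <= 4)%N.
  rewrite -(card_uniqP uw).
  by have := max_card (mem w); rewrite card_prod card_bool.
case: w cw uw => [|x [|y [|z [|t [|]]]]] //; first by constructor 1.
- by constructor 2; exists x.
- move=> cw uw _; constructor 3; exists x, y; split=> //.
    by move: uw; rewrite /= inE andbT eq_sym.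
  by case/andP: cw.
- by case: x => [[] []]; case: y => [[] []]; case: z => [[] []].
- move=> cw uw _; constructor 4; exists x, y; move: cw uw.
  by case: x => [[] []]; case: y => [[] []]; case: z => [[] []]; case: t => [[] []].
Qed.

Lemma length_cyc_reduced w : cyc_reduced w -> l (ev w) = cyc_len d w.
Proof.
move: w; suff IH n : len_agree n by move=> w; apply: (IH (size w)).
elim: n => [|n IHn] w sw cw.
  by move: sw; rewrite leqn0 => /nilP->; rewrite /ev (pl_one pl).
have [uw|] := boolP (uniq w); last exact: len_agree_not_uniq IHn sw cw.
case: (cyc_reduced_uniqP cw uw) => [->|[x ->]|[x [y [->]]]|[x [y [e yx yx']]]].
- by rewrite /ev (pl_one pl).
- exact: l1.
- exact: l2.
rewrite e; apply: len_agree_comm => // v sv; apply: IHn.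
by move: sw; rewrite e /= ltnS; apply: leq_trans.
Qed.

End LengthOfWords.

(** * Uniqueness on [F2] from four values *)

Section Uniqueness.
Variable R : realType.

(* Midpoint distances for the values [al], [be], [ga], [de] at a, b, ab, ab^-1:
   only the directions a and b can share an initial segment. *)
Definition turn_dist (al be ga de : R) (x y : letter bool) : R :=
  if x == y then 0 else
  if x.1 == y.1 then (if x.1 then al else be) else
  if x.2 || y.2 then ga / 2 else de - ga / 2.

Lemma wlift_word (g : F2) : wlift (G := F2) (@gen bool) (word g) = g.
Proof.
exact/esym/(@free_lift_unique _ F2 _ (@idfun F2 : {multiplicative F2 -> F2})).
Qed.

(** The inequalities make [turn_dist] a metric with negative letters as leaves, and cover the
    parameters of both [Y1] and [Y2]. *)
Lemma length_F2E (l : F2 -> R) (al be ga de : R) w : pseudo_length l ->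
    l a = al -> l b = be -> l (a * b)%g = ga -> l (a * b^-1)%g = de ->
    [/\ 0 < be, be <= al & al <= de] -> [/\ de <= ga, al + be <= ga & ga <= be + de] ->
    cyc_reduced w ->
  l (wlift (G := F2) (@gen bool) w) = cyc_len (turn_dist al be ga de) w.
Proof.
move=> pl la lb lab lab' [be0 beal alde] [dega abga gabe].
have lba : l (b * a)%g = ga by rewrite (pl_mulC pl).
have lb'a : l (b^-1 * a)%g = de by rewrite (pl_mulC pl).
have lAB : l (a^-1 * b^-1)%g = ga by rewrite -invgM (pl_inv pl).
have lBA : l (b^-1 * a^-1)%g = ga by rewrite -invgM (pl_inv pl).
have lAb : l (a^-1 * b)%g = de by rewrite -(pl_inv pl) invgM invgK.
have lbA : l (b * a^-1)%g = de by rewrite -(pl_inv pl) invgM invgK.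
apply: length_cyc_reduced => //.
- by case=> [[] []] [[] []].
- by case=> [[] []].
- by case=> [[] []] [[] []] [[] []]; rewrite /turn_dist /=; lra.
- by case=> [[] []] [[] []] [[] []] //= _ _ _; rewrite /turn_dist /=; lra.
- case=> [[] []]; rewrite /= !mulg1 /lletter /turn_dist /= ?addr0 ?(pl_inv pl) //.
case=> [[] []] [[] []] //= _ _; rewrite !mulg1 /lletter /turn_dist /=.
all: rewrite -?/a -?/b ?(lab, lab', lba, lb'a, lAB, lAb, lBA, lbA); lra.
Qed.

Lemma pseudo_length_uniq (l l' : F2 -> R) : pseudo_length l -> pseudo_length l' ->
    l a = l' a -> l b = l' b -> l (a * b)%g = l' (a * b)%g ->
    l (a * b^-1)%g = l' (a * b^-1)%g ->
    [/\ 0 < l b, l b <= l a & l a <= l (a * b^-1)%g] ->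
    [/\ l (a * b^-1)%g <= l (a * b)%g, l a + l b <= l (a * b)%g &
        l (a * b)%g <= l b + l (a * b^-1)%g] ->
  l = l'.
Proof.
move=> pl pl' la lb lab lab' h1 h2; apply/funext => g; rewrite -(wlift_word g).
elim: {g}(size (word g)) {-2}(word g) (leqnn (size (word g))) => [|n IHn] w sw.
  by move: sw; rewrite leqn0 => /nilP->; rewrite /= !pl_one.
have [cw|/not_cyc_reduced_split[p [q [x [s [e1 e2]]]]]] := boolP (cyc_reduced w).
  rewrite (length_F2E pl erefl erefl erefl erefl) //.
  by rewrite (length_F2E pl' (esym la) (esym lb) (esym lab) (esym lab')).
have e : wlift (G := F2) (@gen bool) (q ++ p) = wlift (G := F2) (@gen bool) s.
  by rewrite e2 /= lletterV mulVKg.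
rewrite e1 wlift_cat (pl_mulC pl) (pl_mulC pl') -wlift_cat e IHn //.
by move: sw; rewrite e1 size_cat addnC -size_cat e2 => /ltnW.
Qed.

Lemma norm4_eq (l : F2 -> R) : pseudo_length l ->
    [/\ 0 < l b, l b <= l a & l a <= l (a * b^-1)%g] ->
    [/\ l (a * b^-1)%g <= l (a * b)%g, l a + l b <= l (a * b)%g &
        l (a * b)%g <= l b + l (a * b^-1)%g] ->
  l = norm4 (l a) (l b) (l (a * b)%g) (l (a * b^-1)%g).
Proof.
move=> pl h1 h2; rewrite /norm4; set S := (X in xget _ X).
(* [l] itself witnesses that the choice is not the default value. *)
have [pl' [? ? ? ?]] : S (xget (fun=> 0) S) by apply: xgetPex; exists l.
exact: pseudo_length_uniq.
Qed.

End Uniqueness.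

(** * Bases of [F2] and Nielsen moves *)

Section Orbits.
Variable R : realType.

Lemma gmulf_inv (G H : groupType) (s : {multiplicative G -> H}) g :
  s g^-1%g = (s g)^-1%g.
Proof.
have s1 : s 1%g = 1%g by apply: (@mulgI _ (s 1%g)); rewrite -gmulfM !mulg1.
by apply: (@mulgI _ (s g)); rewrite -gmulfM !mulgV s1.
Qed.

Definition is_basis (x y : F2) := exists s : {multiplicative F2 -> F2},
  [/\ bijective s, s a = x & s b = y].

Definition F2_endo (x y : F2) : {multiplicative F2 -> F2} :=
  free_lift (fun c => if c then x else y).

Lemma F2_endo_a x y : F2_endo x y a = x.
Proof. exact: (@free_lift_gen _ F2 (fun c => if c then x else y) true). Qed.

Lemma F2_endo_b x y : F2_endo x y b = y.
Proof. exact: (@free_lift_gen _ F2 (fun c => if c then x else y) false). Qed.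

Lemma F2_endo_eq [s t : {multiplicative F2 -> F2}] :
  s a = t a -> s b = t b -> s =1 t.
Proof.
move=> ea eb g.
have h (r : {multiplicative F2 -> F2}) c : r (gen c) = if c then r a else r b.
  by case: c.
rewrite (@free_lift_unique _ F2 _ s (h s)) (@free_lift_unique _ F2 _ t (h t)).
by rewrite ea eb.
Qed.

(** The two endomorphisms are mutually inverse, as checked on [a] and [b]. *)
Lemma is_basis_endo x y x' y' :
  F2_endo x y x' = a -> F2_endo x y y' = b ->
  F2_endo x' y' x = a -> F2_endo x' y' y = b -> is_basis x y.
Proof.
move=> e1 e2 e3 e4; exists (F2_endo x y); split; rewrite ?F2_endo_a ?F2_endo_b //.
exists (F2_endo x' y') => g.
  apply: (F2_endo_eq (s := F2_endo x' y' \o F2_endo x y) (t := idfun));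
    by rewrite /= ?F2_endo_a ?F2_endo_b.
apply: (F2_endo_eq (s := F2_endo x y \o F2_endo x' y') (t := idfun));
  by rewrite /= ?F2_endo_a ?F2_endo_b.
Qed.

Lemma is_basis_ab : is_basis a b.
Proof. by apply: (@is_basis_endo a b a b); rewrite ?F2_endo_a ?F2_endo_b. Qed.

(** Reduces a Nielsen move on any basis to the same move on [a], [b]. *)
Lemma is_basis_comp x y (s : {multiplicative F2 -> F2}) : is_basis x y ->
  bijective s -> is_basis (s x) (s y).
Proof.
move=> [t [bt <- <-]] bs; exists (s \o t); split=> //; exact: bij_comp.
Qed.

Lemma is_basis_swap x y : is_basis x y -> is_basis y x.
Proof.
case=> s [bs <- <-]; apply: is_basis_comp => //.
by apply: (@is_basis_endo b a b a); rewrite ?F2_endo_a ?F2_endo_b.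
Qed.

Lemma is_basis_invr x y : is_basis x y -> is_basis x y^-1%g.
Proof.
case=> s [bs <- <-]; rewrite -gmulf_inv; apply: is_basis_comp => //.
by apply: (@is_basis_endo a b^-1%g a b^-1%g);
  rewrite ?gmulf_inv ?F2_endo_a ?F2_endo_b ?invgK.
Qed.

Lemma is_basis_mulV x y : is_basis x y -> is_basis (x * y^-1)%g y.
Proof.
case=> s [bs <- <-]; rewrite -gmulf_inv -gmulfM; apply: is_basis_comp => //.
by apply: (@is_basis_endo (a * b^-1)%g b (a * b)%g b);
  rewrite ?gmulfM ?gmulf_inv ?F2_endo_a ?F2_endo_b ?mulgK ?mulgVK.
Qed.

(** * Reduction of a basis to the normal forms *)

Variable l : F2 -> R.
Hypothesis Psil : Psi l.
Let pl : pseudo_length l := Psil.1.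

Local Notation good := (Aut_orbit l `&` Y' (R := R) !=set0).

Lemma pseudo_length_comp (s : {multiplicative F2 -> F2}) : pseudo_length (l \o s).
Proof.
split=> [g|g h|g h|g h] /=; rewrite ?gmulfM ?gmulf_inv; first exact: pl_ge0.
- exact: pl_A1.
- exact: pl_A2.
- exact: pl_A3.
Qed.

Lemma orbit_norm4 x y : is_basis x y ->
    [/\ 0 < l y, l y <= l x & l x <= l (x * y^-1)%g] ->
    [/\ l (x * y^-1)%g <= l (x * y)%g, l x + l y <= l (x * y)%g &
        l (x * y)%g <= l y + l (x * y^-1)%g] ->
  Aut_orbit l (norm4 (l x) (l y) (l (x * y)%g) (l (x * y^-1)%g)).
Proof.
move=> [s [bs <- <-]]; rewrite -gmulf_inv -!gmulfM => h1 h2.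
exists s => //; exact: (norm4_eq (pseudo_length_comp s)).
Qed.

Lemma basis_gt0 x y : is_basis x y ->
  [/\ 0 < l x, 0 < l y, 0 < l (x * y^-1)%g & 0 < l (x * y * x^-1 * y^-1)%g].
Proof.
case=> s [bs <- <-]; rewrite -!gmulf_inv -!gmulfM.
have gt0 g : g != 1%g -> 0 < l (s g).
  move=> g1; apply: Psil.2 => sg1; case/eqP: g1; apply: (bij_inj bs).
  by rewrite sg1; apply: (@mulgI _ (s 1%g)); rewrite -gmulfM !mulg1.
by split; apply: gt0.
Qed.

Lemma lengths_swap x y :
  [/\ l (y * x)%g = l (x * y)%g, l (y * x^-1)%g = l (x * y^-1)%g &
      l (y * x * y^-1 * x^-1)%g = l (x * y * x^-1 * y^-1)%g].
Proof.
split; first exact: (pl_mulC pl).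
  by rewrite -(pl_inv pl) invgM invgK.
by rewrite -(pl_inv pl) !invgM !invgK !mulgA.
Qed.

Lemma orbit_Y1 x y : is_basis x y -> l (x * y)%g = l x + l y ->
  l (x * y^-1)%g < l x + l y -> l x <= l (x * y^-1)%g -> l y <= l (x * y^-1)%g ->
  good.
Proof.
wlog le : x y / l y <= l x.
  move=> IH; case: (leP (l y) (l x)) => [|/ltW] le; first exact: IH.
  move=> B e1 e2 e3 e4; have [s1 s2 _] := lengths_swap x y.
  by apply: (IH y x) => //; rewrite ?s1 ?s2 //; [exact: is_basis_swap | lra | lra].
move=> B e1 e2 e3 e4; have [x0 y0 z0 _] := basis_gt0 B.
have := orbit_norm4 B; rewrite e1 => O.
eexists; split; first by apply: O; split; lra.
by left; exists (l x), (l y), (l (x * y^-1)%g); split=> //; split; lra.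
Qed.

Lemma orbit_Y2 x y : is_basis x y -> l (x * y)%g = l (x * y^-1)%g ->
  l x + l y <= l (x * y)%g -> good.
Proof.
wlog le : x y / l y <= l x.
  move=> IH; case: (leP (l y) (l x)) => [|/ltW] le; first exact: IH.
  move=> B e1 e2; have [s1 s2 _] := lengths_swap x y.
  by apply: (IH y x) => //; rewrite ?s1 ?s2 //; [exact: is_basis_swap | lra].
move=> B e1 e2; have [x0 y0 z0 _] := basis_gt0 B.
have := orbit_norm4 B; rewrite -e1 => O.
eexists; split; first by apply: O; split; lra.
by right; exists (l x), (l y), (l (x * y)%g); split=> //; split; lra.
Qed.

(* The axes of [x] and [y] overlap coherently; [4 * c] bounds the length of the
   commutator, the same for all bases, from below. *)
Definition overlapping (c : R) (x y : F2) :=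
  [/\ is_basis x y, l (x * y)%g = l x + l y, l (x * y^-1)%g < l x + l y &
      4 * c <= l (x * y * x^-1 * y^-1)%g].

Lemma overlapping_swap c x y : overlapping c x y -> overlapping c y x.
Proof.
move=> [B e1 e2 e3]; have [s1 s2 s3] := lengths_swap x y.
by split; rewrite ?s1 ?s2 ?s3 //; [exact: is_basis_swap | lra | lra].
Qed.

Lemma overlapping_ge c x y : overlapping c x y -> 2 * c <= l x + l y.
Proof.
move=> [B e1 e2 e3]; suff : l (x * y * x^-1 * y^-1)%g <= 2 * (l x + l y) by lra.
by apply: (pl_comm_le pl); lra.
Qed.

(** (A3) is applied to [x y^-1] and [y], with products [x] and [x y^-2]. Equal products give [Y2];
    if [x y^-2] is longer, inverting [y] gives [Y1]; if [x] is, this is a Euclidean step, and the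
    commutator is unchanged. *)
Lemma overlapping_step c x y : overlapping c x y -> l y <= l x ->
  good \/ overlapping c (x * y^-1)%g y /\ l (x * y^-1)%g = l x - l y.
Proof.
move=> [B e1 e2 e3] le; have [x0 y0 z0 k0] := basis_gt0 B.
have [ge|lt] := leP (l x) (l (x * y^-1)%g).
  by left; apply: (orbit_Y1 B) => //; lra.
have B' := is_basis_mulV B.
have ek : (x * y^-1 * y * (x * y^-1)^-1 * y^-1 = x * y * x^-1 * y^-1)%g.
  by rewrite mulgVK invgM invgK !mulgA.
case: (pl_A3 pl z0 y0) => [[eq gt]|]; first by left; apply: (orbit_Y2 B') => //; lra.
rewrite mulgVK; case: (ltgtP (l x) (l (x * y^-1 * y^-1)%g)) => [lt1|gt1|eq] e.
- left; apply: (orbit_Y1 (is_basis_invr B')); rewrite ?invgK ?mulgVK ?(pl_inv pl) //; lra.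
- right; split; last lra.
  by split=> //; rewrite ?ek ?mulgVK //; lra.
- by left; apply: (orbit_Y2 B'); rewrite mulgVK //; lra.
Qed.

(** As the sum is at least [2 * c], [y] stays the shorter element, and each step lowers [n] by
    one. *)
Lemma overlapping_small c n x y : overlapping c x y -> l y < c ->
  l x <= n%:R * l y -> good.
Proof.
elim: n x => [|n IHn] x O yc xn; have ge := overlapping_ge O.
  by have [B _ _ _] := O; have [x0 _ _ _] := basis_gt0 B; lra.
have [//|[O' e]] := overlapping_step O (ltac:(lra) : l y <= l x).
by apply: (IHn _ O') => //; rewrite e; move: xn; rewrite -natr1; lra.
Qed.

(** A step lowers the sum by [l y], hence by at least [c] unless [l y < c], the case of
    [overlapping_small]. *)
Lemma overlapping_good c n x y : 0 < c -> overlapping c x y ->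
  l x + l y <= n%:R * c -> good.
Proof.
move=> c0; elim: n x y => [|n IHn] x y O.
  by have := overlapping_ge O; lra.
wlog le : x y O / l y <= l x.
  move=> IH; case: (leP (l y) (l x)) => [|/ltW] le; first exact: IH.
  by rewrite addrC; apply: IH => //; exact: overlapping_swap.
move=> xn; have [B _ _ _] := O; have [_ y0 _ _] := basis_gt0 B.
have [yc|cy] := ltP (l y) c.
  have [m /ltW] : exists m, l x / l y < m%:R.
    by exists (Num.truncn (l x / l y)).+1; exact: truncnS_gt.
  by rewrite ler_pdivrMr //; exact: overlapping_small O yc.
have [//|[O' e]] := overlapping_step O le.
by apply: (IHn _ _ O'); rewrite e; move: xn; rewrite -natr1; lra.
Qed.

Lemma overlapping_orbit c x y : 0 < c -> overlapping c x y -> good.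
Proof.
move=> c0 O; apply: (overlapping_good (n := (Num.truncn ((l x + l y) / c)).+1) c0 O).
by rewrite -ler_pdivrMr // ltW // truncnS_gt.
Qed.

End Orbits.

Theorem mainTheorem5 (R : realType) (l : F2 -> R) :
  Psi l -> Aut_orbit l `&` Y' (R := R) !=set0.
Proof.
move=> Psil; have pl := Psil.1; have B := is_basis_ab.
have B' := is_basis_invr B.
have [a0 b0 _ k0] := basis_gt0 Psil B; have [_ b'0 _ k'0] := basis_gt0 Psil B'.
case: (pl_A3 pl a0 b0) => [[e lt]|]; first by apply: (orbit_Y2 Psil B); lra.
case: (ltgtP (l (a * b)%g) (l (a * b^-1)%g)) => [lt|gt|eq] e.
(* Inverting [b] makes the product the longer one; [c] is a quarter of the positive commutator
   length. *)
- apply: (overlapping_orbit Psil (x := a) (y := b^-1%g)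
      (c := l (a * b^-1 * a^-1 * b^-1^-1)%g / 4)); first lra.
  by split; rewrite ?(pl_inv pl) ?invgK //; lra.
- apply: (overlapping_orbit Psil (x := a) (y := b)
      (c := l (a * b * a^-1 * b^-1)%g / 4)); first lra.
  by split => //; lra.
by apply: (orbit_Y2 Psil B); lra.
Qed.
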